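(* Let $z\in\mathcal W=\{u\in\mathbb{R}^m:u_1<\cdots<u_m\}$, let $(q_\ell)_{\ell\ge1}$ be scalar queries differentiable at $z$ with sensitivities $\Delta_{2,\ell}>0$, let $(\kappa_L)_{L\ge1}$ be positive scalars, and for each $L$ consider the releases $y_\ell=q_\ell(z)+w_\ell$, $\ell=1,\dots,L$, with independent $w_\ell\sim\mathcal N(0,\kappa_L\Delta_{2,\ell}^2)$. Let $$\bm A_L(z)=\sum_{\ell=1}^L g_\ell(z)g_\ell(z)^\top,\qquad g_\ell(z)=\Delta_{2,\ell}^{-1}\nabla_z q_\ell(z),$$ and let $\mathrm{CRB}_{\mathrm{unlab}}(L)$ be the local unlabeled Cramér--Rao benchmark. Then: (i) Assume an identifiable stage exists, i.e. $L_{\mathrm{id}}:=\min\{L:\bm A_L(z)\succ\bm 0\}<\infty$. If $\lambda_{\min}(\bm A_L(z))=o(\kappa_L)$ as $L\to\infty$, then $\mathrm{CRB}_{\mathrm{unlab}}(L)\to\infty$ as $L\to\infty$. Combined with rank deficiency for $L<L_{\mathrm{id}}$, the function $L\mapsto\mathrm{CRB}_{\mathrm{unlab}}(L)$ admits a finite minimizer $L^\star\in[L_{\mathrm{id}},\infty)$. (ii) As $L\to\infty$, $$\mathrm{CRB}_{\mathrm{unlab}}(L)\to0\iff\frac{\lambda_{\min}(\bm A_L(z))}{\kappa_L}\to\infty.$$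
   Context: The Fisher information matrix for $z$ from the first $L$ releases is $\bm I_C(L)=\kappa_L^{-1}\bm A_L(z)$. The benchmark is $\mathrm{CRB}_{\mathrm{unlab}}(L):=\operatorname{tr}(\bm I_C(L)^{-1})$, with the convention that it equals $+\infty$ when $\bm I_C(L)$ is singular. $\lambda_{\min}$ denotes the smallest eigenvalue. The vector $z$ is the sorted vector of the $m$ pairwise distinct scalar values of a fixed membership set. *)

(* Defs.v *)
From HB Require Import structures.
From mathcomp Require Import all_boot all_order all_algebra.
From mathcomp Require Import all_classical all_reals all_analysis.

Set Implicit Arguments.
Unset Strict Implicit.
Unset Printing Implicit Defensive.

Import Order.TTheory GRing.Theory Num.Theory.
Import numFieldNormedType.Exports.

Local Open Scope classical_set_scope.
Local Open Scope ring_scope.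

Definition in_sorted_chamber (R : realType) (m : nat) (z : 'cV[R]_m) : Prop :=
  forall i j : 'I_m, (i < j)%N -> z i 0 < z j 0.

Definition partial (R : realType) (m : nat) (f : 'cV[R]_m -> R) (i : 'I_m)
    (u : 'cV[R]_m) : R :=
  'D_(delta_mx i 0) f u.

Definition gradient (R : realType) (m : nat) (f : 'cV[R]_m -> R)
    (u : 'cV[R]_m) : 'cV[R]_m :=
  \col_i partial f i u.

Definition posdefmx (R : realType) (m : nat) (A : 'M[R]_m) : Prop :=
  A \is symmetricmx /\
  forall v : 'cV[R]_m, v != 0 -> 0 < (v^T *m A *m v) 0 0.

(* The spectrum is finite, and nonempty when A is symmetric and m > 0; the
   infimum is then attained. *)
Definition lambda_min (R : realType) (m : nat) (A : 'M[R]_m) : R :=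
  inf [set a : R | eigenvalue A a].

Definition mutually_independent (d : measure_display) (T : measurableType d)
    (R : realType) (P : probability T R) (I : eqType) (D : {pred I})
    (X : I -> {RV P >-> R}) : Prop :=
  forall J : seq I, uniq J -> {subset J <= D} ->
  forall B : I -> set R, (forall i, measurable (B i)) ->
    P (\bigcap_(i in [set` J]) X i @^-1` B i) =
    (\prod_(i <- J) P (X i @^-1` B i))%E.

(* N(mu, v) is parametrized by its variance v; the library's normal_prob and
   normal_pdf take the standard deviation. *)
Definition is_gaussian (d : measure_display) (T : measurableType d)
    (R : realType) (P : probability T R) (X : {RV P >-> R}) (mu v : R) : Prop :=
  forall B : set R, measurable B ->
    distribution P X B = normal_prob mu (Num.sqrt v) B.

Definition gaussian_pdf (R : realType) (mu v x : R) : R :=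
  normal_pdf mu (Num.sqrt v) x.

(* p u is the density of the observation Y when the parameter is u; the
   expectation is taken under the law of Y at the parameter value u. *)
Definition score (R : realType) (m : nat) (S : Type) (p : 'cV[R]_m -> S -> R)
    (u : 'cV[R]_m) (y : S) : 'cV[R]_m :=
  gradient (fun v => ln (p v y)) u.

Definition fisher_information (d : measure_display) (T : measurableType d)
    (R : realType) (P : probability T R) (m : nat) (S : Type)
    (p : 'cV[R]_m -> S -> R) (u : 'cV[R]_m) (Y : T -> S) : 'M[R]_m :=
  \matrix_(i, j)
    fine 'E_P[fun t => score p u (Y t) i 0 * score p u (Y t) j 0].

(* Queries, sensitivities and releases are indexed from 1; the value of a
   family at index 0 is never used. *)
Section releases.
Variables (R : realType) (m : nat).
Variables (q : nat -> 'cV[R]_m -> R) (Delta : nat -> R) (kappa : nat -> R).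

Definition noise_variance (L l : nat) : R := kappa L * Delta l ^+ 2.

Definition whitened_gradient (l : nat) (z : 'cV[R]_m) : 'cV[R]_m :=
  (Delta l)^-1 *: gradient (q l) z.

Definition Amx (L : nat) (z : 'cV[R]_m) : 'M[R]_m :=
  \sum_(1 <= l < L.+1) whitened_gradient l z *m (whitened_gradient l z)^T.

Definition release (d : measure_display) (T : measurableType d)
    (P : probability T R) (w : nat -> {RV P >-> R}) (z : 'cV[R]_m)
    (t : T) (l : nat) : R :=
  q l z + w l t.

(* Joint density of (y_1, ..., y_L) at parameter u; only the coordinates
   1, ..., L of y are read. *)
Definition release_density (L : nat) (u : 'cV[R]_m) (y : nat -> R) : R :=
  \prod_(1 <= l < L.+1) gaussian_pdf (q l u) (noise_variance L l) (y l).

Definition release_information (d : measure_display) (T : measurableType d)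
    (P : probability T R) (w : nat -> {RV P >-> R}) (L : nat)
    (z : 'cV[R]_m) : 'M[R]_m :=
  fisher_information P (release_density L) z (release w z).

End releases.

Definition cramer_rao (R : realType) (m : nat) (I : 'M[R]_m) : \bar R :=
  if I \in unitmx then (\tr (invmx I))%:E else +oo%E.

(* Main.v *)
(* The score of a Gaussian release is linear in the noises, which are centred and
   uncorrelated, so the Fisher information of the first L releases is
   kappa_L^-1 A_L.  Since A_L is positive semidefinite with smallest eigenvalue
   lambda_L, the trace of its inverse lies between 1/lambda_L and m/lambda_L;
   hence the benchmark is comparable to kappa_L/lambda_L up to the factor m, and
   is infinite exactly when lambda_L = 0. *)
Require Import Defs.
From HB Require Import structures.
From mathcomp Require Import all_boot all_order all_algebra.
From mathcomp Require Import all_classical all_reals all_analysis.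
From mathcomp Require Import measurable_realfun ring lra.

Set Implicit Arguments.
Unset Strict Implicit.
Unset Printing Implicit Defensive.

Import Order.TTheory GRing.Theory Num.Theory.
Import numFieldNormedType.Exports.

Local Open Scope classical_set_scope.
Local Open Scope ring_scope.

(** The spectral estimates avoid diagonalization: each is the nonnegativity of a quadratic form at a
    well-chosen vector. The pivot is [posdef_bform_ge], that is |v|^2 <= tr(A^-1) v^T A v, an
    explicit coercivity bound that replaces compactness of the unit sphere. The factor m counts the
    diagonal entries of A^-1, each at most 1/lambda. On the probabilistic side, centring comes from
    evenness of the density, the variance from integration by parts, and uncorrelatedness from
    Fubini on the joint law of two noises. Every stage L has its own probability space, so stages
    are compared only through kappa_L and A_L; the asymptotic part is therefore stated for abstract
    sequences. The minimizer exists because divergence leaves finitely many stages to compare. *)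

Section bilinear_form.
Variables (R : realType) (m : nat).
Implicit Types (A B : 'M[R]_m) (u v : 'cV[R]_m) (t : R).

(** * Quadratic forms and positive semidefinite matrices *)

Definition bform A u v : R := (u^T *m A *m v) 0 0.

Definition psdmx A := A^T = A /\ forall v, 0 <= bform A v v.

Lemma bformDl A u1 u2 v : bform A (u1 + u2) v = bform A u1 v + bform A u2 v.
Proof. by rewrite /bform linearD/= !mulmxDl mxE. Qed.

Lemma bformDr A u v1 v2 : bform A u (v1 + v2) = bform A u v1 + bform A u v2.
Proof. by rewrite /bform mulmxDr mxE. Qed.

Lemma bformZl A t u v : bform A (t *: u) v = t * bform A u v.
Proof. by rewrite /bform linearZ/= -!scalemxAl mxE. Qed.

Lemma bformZr A t u v : bform A u (t *: v) = t * bform A u v.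
Proof. by rewrite /bform -scalemxAr mxE. Qed.

Lemma bformD A B u v : bform (A + B) u v = bform A u v + bform B u v.
Proof. by rewrite /bform mulmxDr mulmxDl mxE. Qed.

Lemma bformZ t A u v : bform (t *: A) u v = t * bform A u v.
Proof. by rewrite /bform -scalemxAr -scalemxAl mxE. Qed.

Lemma bform_sum (I : Type) (s : seq I) (F : I -> 'M[R]_m) u v :
  bform (\sum_(i <- s) F i) u v = \sum_(i <- s) bform (F i) u v.
Proof. by rewrite /bform mulmx_sumr mulmx_suml summxE. Qed.

Lemma bform_mulr A u v : bform A u v = bform 1%:M u (A *m v).
Proof. by rewrite /bform mulmx1 mulmxA. Qed.

Lemma bformC A u v : A^T = A -> bform A u v = bform A v u.
Proof.
move=> As; rewrite /bform.
have -> : u^T *m A *m v = (v^T *m A *m u)^T.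
  by rewrite !trmx_mul trmxK As mulmxA.
by rewrite mxE.
Qed.

Lemma bform_sqrD A t u v : A^T = A ->
  bform A (t *: u + v) (t *: u + v) =
  t ^+ 2 * bform A u u + 2 * t * bform A u v + bform A v v.
Proof.
move=> As; rewrite bformDl !bformDr !bformZl !bformZr (bformC v u As); ring.
Qed.

Lemma bform_subZ A t u v :
  bform (A - t *: 1%:M) u v = bform A u v - t * bform 1%:M u v.
Proof. by rewrite bformD -scaleNr bformZ mulNr. Qed.

Lemma bform1E u : bform 1%:M u u = \sum_i u i 0 ^+ 2.
Proof.
rewrite /bform mulmx1 mxE; apply: eq_bigr => i _.
by rewrite mxE expr2.
Qed.

Lemma bform1_ge0 u : 0 <= bform 1%:M u u.
Proof. by rewrite bform1E sumr_ge0// => i _; exact: sqr_ge0. Qed.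

Lemma bform1_eq0 u : (bform 1%:M u u == 0) = (u == 0).
Proof.
rewrite bform1E psumr_eq0 => [|i _]; last exact: sqr_ge0.
apply/allP/eqP => [u0|-> i _]; last by rewrite mxE expr0n eqxx.
apply/colP => i; rewrite mxE.
by have /= := u0 i (mem_index_enum i); rewrite sqrf_eq0 => /eqP.
Qed.

Lemma bform1_gt0 u : u != 0 -> 0 < bform 1%:M u u.
Proof. by rewrite lt_def bform1_ge0 bform1_eq0 andbT. Qed.

Lemma bform_delta A i : bform A (delta_mx i 0) (delta_mx i 0) = A i i.
Proof. by rewrite /bform trmx_delta -rowE -colE !mxE. Qed.

Lemma mxtrace_ge0 A : psdmx A -> 0 <= \tr A.
Proof.
by move=> [_ A0]; apply: sumr_ge0 => i _; rewrite -bform_delta.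
Qed.

Lemma symmetricmxE A : (A \is symmetricmx) = (A^T == A).
Proof. by rewrite is_hermitianmxE expr0 scale1r map_mx_id// eq_sym. Qed.

Lemma posdef_psd A : posdefmx A -> psdmx A.
Proof.
move=> [/[!symmetricmxE]/eqP As A0]; split=> // v.
have [->|v0] := eqVneq v 0; last exact/ltW/A0.
by rewrite /bform mulmx0 mxE.
Qed.

(* With M := |x|^2 I - x x^T one has M^2 = |x|^2 M, so that
   tr (M B M) = |x|^2 (|x|^2 tr B - x^T B x). *)
Lemma psd_bform_le_trace B x : psdmx B ->
  bform B x x <= \tr B * bform 1%:M x x.
Proof.
move=> [Bs B0]; have [->|x0] := eqVneq x 0.
  by rewrite /bform !mulmx0 mxE mulr0.
set n := bform 1%:M x x; have n0 : 0 < n by exact: bform1_gt0.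
pose M : 'M[R]_m := n *: 1%:M - x *m x^T.
have Ms : M^T = M.
  by rewrite /M linearB/= trmx_mul trmxK linearZ/= trmx1.
have xx : x^T *m x = n%:M by rewrite [LHS]mx11_scalar /n /bform mulmx1.
have PP : x *m x^T *m (x *m x^T) = n *: (x *m x^T).
  by rewrite mulmxA -(mulmxA x) xx mul_mx_scalar scalemxAl.
have MM : M *m M = n *: M.
  rewrite {1}/M mulmxBl -scalemxAl mul1mx {2}/M mulmxBr -scalemxAr mulmx1.
  by rewrite PP subrr subr0.
have /mxtrace_ge0 : psdmx (M *m B *m M).
  split; first by rewrite !trmx_mul Ms Bs mulmxA.
  move=> v; have := B0 (M *m v).
  by rewrite /bform trmx_mul Ms !mulmxA.
rewrite -mulmxA mxtrace_mulC -mulmxA MM -scalemxAr mxtraceZ pmulr_rge0//.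
rewrite /M mulmxBr -scalemxAr mulmx1 linearB/= mxtraceZ subr_ge0.
have -> : \tr (B *m (x *m x^T)) = bform B x x.
  by rewrite mulmxA mxtrace_mulC mulmxA /bform /mxtrace big_ord1.
by rewrite mulrC.
Qed.

(** Perturb v along w = A v: the form at t w + v equals t^2 w^T A w + 2 t |w|^2, which is negative
    for small t < 0 unless w = 0. *)
Lemma psd_kernel A v : psdmx A -> bform A v v = 0 -> A *m v = 0.
Proof.
move=> [As A0] v0; apply/eqP; rewrite -bform1_eq0; apply/eqP.
set w := A *m v; set b := bform _ _ _; set c := bform A w w.
have b0 : 0 <= b by exact: bform1_ge0.
have c0 : 0 <= c by exact: A0.
have wv : bform A w v = b by rewrite bform_mulr.
(* The minimizing value would be -b/c; using c + 1 keeps the denominator positive when c = 0. *)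
pose t := - b / (c + 1).
have := A0 (t *: w + v).
rewrite bform_sqrD// v0 -/c wv => h.
have c1 : 0 < c + 1 by rewrite ltr_wpDl.
have tc : t * (c + 1) = - b by rewrite /t divfK// gt_eqF.
apply/eqP; rewrite eq_le b0 andbT; nra.
Qed.

Lemma unitmx_col0P A : reflect (forall v, A *m v = 0 -> v = 0) (A \in unitmx).
Proof.
rewrite unitmxE unitfE -det_tr; apply: (iffP idP) => [dA v Av|Av].
  apply/eqP/negPn/negP => v0; move/negP : dA; apply; apply/det0P.
  exists v^T; first by rewrite -trmx0 (inj_eq trmx_inj).
  by rewrite -trmx_mul Av trmx0.
apply/negP => /det0P[v /eqP v0 vA]; apply: v0.
apply: trmx_inj; rewrite trmx0; apply: Av.
by apply: trmx_inj; rewrite trmx_mul trmxK vA trmx0.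
Qed.

Lemma posdef_unitmx A : posdefmx A -> A \in unitmx.
Proof.
move=> [_ A0]; apply/unitmx_col0P => v Av; apply/eqP/negPn/negP => /A0.
by rewrite -mulmxA Av mulmx0 mxE ltxx.
Qed.

Lemma psd_unitmx_posdef A : psdmx A -> A \in unitmx -> posdefmx A.
Proof.
move=> [As A0] /unitmx_col0P Au; split; first by rewrite symmetricmxE As.
move=> v v0; rewrite lt_def [X in _ && X]A0 andbT; apply: contra v0 => /eqP Av.
by apply/eqP/Au/psd_kernel.
Qed.

Lemma bform_invmx A v : A \in unitmx -> A^T = A ->
  bform (invmx A) v v = bform A (invmx A *m v) (invmx A *m v).
Proof.
by move=> Au As; rewrite /bform trmx_mul trmx_inv As !mulmxA mulmxKV.
Qed.

Lemma psd_invmx A : psdmx A -> A \in unitmx -> psdmx (invmx A).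
Proof.
move=> [As A0] Au; split; first by rewrite trmx_inv As.
by move=> v; rewrite bform_invmx.
Qed.

(** Write B = A^-1, t = tr B, n = |v|^2, a = v^T A v and c = v^T B v. The form of B at v - t A v
    gives t^2 a - 2 t n + c >= 0, and c <= t n by [psd_bform_le_trace], hence t (t a - n) >= 0. *)
Lemma posdef_bform_ge A v : posdefmx A ->
  bform 1%:M v v <= \tr (invmx A) * bform A v v.
Proof.
move=> Apd; have [As A0] := posdef_psd Apd; have Au := posdef_unitmx Apd.
set B := invmx A; have Bpsd : psdmx B by apply: psd_invmx => //; split.
have t0 : 0 <= \tr B by exact: mxtrace_ge0.
have h w u : bform B (A *m w) u = bform 1%:M w u.
  by rewrite /bform trmx_mul As mulmx1 -[_ *m A *m B]mulmxA mulmxV// mulmx1.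
have hA : bform B (A *m v) (A *m v) = bform A v v.
  by rewrite h -bform_mulr.
have hv := psd_bform_le_trace v Bpsd.
case: (Bpsd) => Bs B0.
have := B0 (- \tr B *: (A *m v) + v).
rewrite bform_sqrD// hA h; move: hv; set n := bform 1%:M v v.
set a := bform A v v; set c := bform B v v.
set t := \tr B => hv hh.
have : 0 <= t * (t * a - n) by nra.
(* The factor [t] cancels only when nonzero. If it is zero, then [c = 0], so [B *m v = 0] and
   [v = 0]. *)
have [t00|t_gt0] := eqVneq t 0.
  have v00 : n <= 0.
    have : c = 0 by apply/eqP; rewrite eq_le B0 andbT; nra.
    move=> /(psd_kernel Bpsd) Bv.
    have -> : n = 0; last by [].
    apply/eqP; rewrite bform1_eq0.
    by rewrite -[v]mul1mx -(mulmxV Au) -mulmxA Bv mulmx0.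
  by nra.
by rewrite pmulr_rge0 ?subr_ge0// lt_def t_gt0.
Qed.

End bilinear_form.

(** * The smallest eigenvalue and the trace of the inverse *)

Section lambda_min.
Variables (R : realType) (m : nat) (m_gt0 : (0 < m)%N).
Implicit Types (A : 'M[R]_m) (v : 'cV[R]_m).

(* The supremum s of the t such that A - t I is positive semidefinite is an
   eigenvalue: otherwise A - s I would be positive definite, hence bounded below
   by a positive multiple of I, and s could be increased. *)
Lemma lambda_minP A : psdmx A ->
  [/\ 0 <= lambda_min A,
      (exists2 v : 'cV[R]_m, v != 0 & A *m v = lambda_min A *: v) &
      forall v, lambda_min A * bform 1%:M v v <= bform A v v].
Proof.
move=> [As A0].
pose S := [set t : R | forall v, t * bform 1%:M v v <= bform A v v].
have S0 : S 0 by move=> v; rewrite mul0r.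
pose e0 : 'cV[R]_m := delta_mx (Ordinal m_gt0) 0.
have e01 : bform 1%:M e0 e0 = 1 by rewrite bform_delta mxE eqxx.
have ubS : has_sup S.
  split; first by exists 0.
  by exists (bform A e0 e0) => t /(_ e0); rewrite e01 mulr1.
set s := sup S.
have s0 : 0 <= s by exact: sup_upper_bound.
have Ss : S s.
  move=> v; have [->|v0] := eqVneq v 0.
    by rewrite /bform !mulmx0 mxE mulr0.
  rewrite -ler_pdivlMr ?bform1_gt0//; apply: ge_sup; first by exists 0.
  by move=> t St; rewrite ler_pdivlMr ?bform1_gt0.
pose C := A - s *: 1%:M.
have Cpsd : psdmx C.
  split; first by rewrite linearB/= linearZ/= trmx1 As.
  by move=> v; rewrite bform_subZ subr_ge0.
have /unitmx_col0P/existsNP[v /not_implyP[Cv v0]] : C \notin unitmx.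
  apply/negP => /(psd_unitmx_posdef Cpsd) Cpd.
  have /= h := posdef_bform_ge _ Cpd.
  have t0 : 0 < \tr (invmx C).
    rewrite lt_def (mxtrace_ge0 (psd_invmx Cpsd (posdef_unitmx Cpd))) andbT.
    by apply/eqP => t0; have := h e0; rewrite t0 e01 mul0r ler10.
  (* By [h], the form of [C] dominates that of the identity divided by [\tr (invmx C)], so [s] can
     be raised by exactly this amount. *)
  have : S (s + (\tr (invmx C))^-1).
    move=> v; have := h v.
    rewrite bform_subZ mulrDl -lerBrDl => hv.
    by rewrite mulrC ler_pdivrMr// mulrC.
  move=> /(sup_upper_bound ubS); rewrite gerDl leNgt invr_gt0.
  by rewrite t0.
have Av : A *m v = s *: v.
  by move/eqP: Cv; rewrite mulmxBl -scalemxAl mul1mx subr_eq0 => /eqP.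
have vn0 : v != 0 by exact/eqP.
have es : eigenvalue A s.
  apply/eigenvalueP; exists v^T; last by rewrite -trmx0 (inj_eq trmx_inj).
  by apply: trmx_inj; rewrite trmx_mul trmxK As Av linearZ/= trmxK.
have lbs : lbound [set a : R | eigenvalue A a] s.
  move=> a /eigenvalueP[u uA u0].
  have uT0 : u^T != 0 by rewrite -trmx0 (inj_eq trmx_inj).
  have := Ss u^T; rewrite (bform_mulr A).
  have -> : A *m u^T = a *: u^T by rewrite -{1}As -trmx_mul uA linearZ.
  by rewrite bformZr ler_pM2r// bform1_gt0.
suff -> : lambda_min A = s by split=> //; exists v.
apply/eqP; rewrite eq_le; apply/andP; split.
  by apply: ge_inf => //; exists s.
by apply: lb_le_inf => //; exists s.
Qed.

(** Translates the invertibility test inside [cramer_rao] into a condition on the eigenvalue. *)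
Lemma lambda_min_gt0 A : psdmx A -> (0 < lambda_min A) = (A \in unitmx).
Proof.
move=> Apsd; have [l0 [v v0 Av] lA] := lambda_minP Apsd.
apply/idP/idP => [l_gt0|/(psd_unitmx_posdef Apsd)[_ /(_ v v0)]].
  apply: posdef_unitmx; split; first by rewrite symmetricmxE; case: Apsd => ->.
  move=> u u0; apply: lt_le_trans (lA u).
  by rewrite mulr_gt0// bform1_gt0.
rewrite -mulmxA Av -scalemxAr mxE -[X in X *m v]mulmx1.
by rewrite pmulr_lgt0// bform1_gt0.
Qed.

(** The lower bound is [psd_bform_le_trace] for [invmx A] at an eigenvector of [lambda_min A]; the
    upper bound sums m diagonal entries, each the form of [invmx A] at a unit vector. *)
Lemma trace_invmx_bounds A : posdefmx A ->
  (lambda_min A)^-1 <= \tr (invmx A) <= m%:R * (lambda_min A)^-1.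
Proof.
move=> Apd; have Apsd := posdef_psd Apd; have Au := posdef_unitmx Apd.
have l_gt0 : 0 < lambda_min A by rewrite lambda_min_gt0.
have [_ [v v0 Av] lA] := lambda_minP Apsd.
set l := lambda_min A in l_gt0 lA Av *.
have Bpsd := psd_invmx Apsd Au.
have [As _] := Apsd.
apply/andP; split.
  have Bv : invmx A *m v = l^-1 *: v.
    rewrite -[in RHS](mulKmx Au v) Av -scalemxAr scalerA mulVf ?scale1r//.
    by rewrite gt_eqF.
  have := psd_bform_le_trace v Bpsd.
  rewrite bform_mulr Bv bformZr ler_pM2r//; exact: bform1_gt0.
(* With y = A^-1 x, expand |x - l y|^2 >= 0 and use l |y|^2 <= y^T A y = y^T x. *)
have h x : bform (invmx A) x x <= l^-1 * bform 1%:M x x.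
  rewrite bform_invmx//; set y := invmx A *m x.
  have Ay : A *m y = x by rewrite mulKVmx.
  have h1 := lA y.
  have := bform1_ge0 (- l *: y + x).
  have h3 : bform 1%:M y x = bform A y y by rewrite [RHS]bform_mulr Ay.
  rewrite bform_sqrD ?trmx1// h3 => h4.
  rewrite ler_pdivlMl//; nra.
rewrite /mxtrace -[m in m%:R]card_ord -sum1_card natr_sum mulr_suml.
apply: ler_sum => i _; rewrite -bform_delta mul1r.
by apply: le_trans (h _) _; rewrite bform_delta mxE eqxx mulr1.
Qed.

Lemma cramer_rao_singular (k : R) A : 0 < k -> psdmx A ->
  ~~ (0 < lambda_min A) -> cramer_rao (k^-1 *: A) = +oo%E.
Proof.
move=> k0 /lambda_min_gt0 ->; rewrite /cramer_rao unitmxZ ?unitfE ?invr_neq0 ?gt_eqF//.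
by move=> /negbTE ->.
Qed.

Lemma cramer_rao_bounds (k : R) A : 0 < k -> psdmx A -> 0 < lambda_min A ->
  ((k / lambda_min A)%:E <= cramer_rao (k^-1 *: A) <=
   (m%:R * (k / lambda_min A))%:E)%E.
Proof.
move=> k0 Apsd; rewrite (lambda_min_gt0 Apsd) => Au.
have kA : k^-1 *: A \in unitmx by rewrite unitmxZ ?unitfE ?invr_neq0 ?gt_eqF.
have := trace_invmx_bounds (psd_unitmx_posdef Apsd Au).
rewrite /cramer_rao kA invmxZ// invrK mxtraceZ !lee_fin ler_pM2l// => /andP[-> ?].
by rewrite mulrCA ler_pM2l.
Qed.

End lambda_min.

(** * Second moment of the centred normal density *)

Section normal_moments.
Variables (R : realType) (s : R) (s_neq0 : s != 0).
Let mu := @lebesgue_measure R.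
Local Notation pdf := (normal_pdf 0 s).

Lemma is_derive_normal_pdf (x : R) : is_derive x 1 pdf (- (x / s ^+ 2) * pdf x).
Proof.
rewrite normal_pdfE//; apply: is_derive_eq.
rewrite /normal_fun !scaler0 /GRing.scale/= -mulr_natr; field.
by [].
Qed.

Lemma normal_pdf_sym x : pdf (- x) = pdf x.
Proof. by rewrite normal_pdfE// /normal_fun !subr0 sqrrN. Qed.

Lemma continuous_sqr_normal_pdf : continuous (fun x : R => x ^+ 2 * pdf x).
Proof.
move=> x; apply: cvgM; first exact: exprn_continuous.
exact: continuous_normal_pdf.
Qed.

(** Integration by parts: [x * pdf x] is the derivative of [- s ^+ 2 * pdf x], and the boundary term
    vanishes at 0. *)
Lemma integral_itv_sqr_normal_pdf (a : R) : 0 < a ->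
  (\int[mu]_(x in `[0%R, a]) (x ^+ 2 * pdf x)%:E =
   (- (s ^+ 2 * (a * pdf a)))%:E + (s ^+ 2)%:E * \int[mu]_(x in `[0%R, a]) (pdf x)%:E)%E.
Proof.
move=> a0.
have dG (x : R) : is_derive x 1 (fun y => - s ^+ 2 * pdf y) (x * pdf x).
  have H := is_derive_normal_pdf x; apply: is_derive_eq.
  by rewrite /GRing.scale/=; field.
have cid x : {for x, continuous (fun y : R => y)} by exact: cvg_id.
have cG : continuous (fun y => - s ^+ 2 * pdf y).
  by move=> x; apply: cvgM; [exact: cvg_cst|exact: continuous_normal_pdf].
have := @integration_by_parts R id (fun y => - s ^+ 2 * pdf y) (cst 1)
  (fun y => y * pdf y) 0 a a0.
under eq_integral do rewrite mulrA -expr2.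
move=> ->; last 6 first.
- by apply: continuous_subspaceT => x; exact: cvg_cst.
- split; first by move=> x _; exact: derivable_id.
    by apply: cvg_at_right_filter; exact: cid.
  by apply: cvg_at_left_filter; exact: cid.
- by move=> x _; rewrite derive1E derive_id.
- apply: continuous_subspaceT => x.
  by apply: cvgM; [exact: cid|exact: continuous_normal_pdf].
- split; first by move=> x _; exact: ex_derive.
    by apply: cvg_at_right_filter; exact: cG.
  by apply: cvg_at_left_filter; exact: cG.
- by move=> x _; rewrite derive1E; exact: derive_val.
rewrite mul0r subr0; congr (_ + _)%E; first by congr EFin; ring.
under eq_integral do rewrite /= mul1r EFinM.
rewrite integralZl//.
  by rewrite EFinN mulNe oppeK.
by apply: (integrableS measurableT) => //; exact: integrable_normal_pdf.
Qed.

(** The boundary term along the intervals [0, n] that exhaust the half-line. Since exp(u) >= 1 + u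
    with u = n^2 / (2 s^2), it is at most a constant over n. *)
Lemma cvg_mul_normal_pdf : (n%:R * pdf n%:R) @[n --> \oo] --> (0 : R).
Proof.
have c0 : 0 < normal_peak s * (s ^+ 2 *+ 2).
  by rewrite mulr_gt0 ?normal_peak_gt0// pmulrn_lgt0// exprn_even_gt0.
apply: (@squeeze_cvgr _ _ _ _ (cst 0) (fun n => normal_peak s * (s ^+ 2 *+ 2) * n%:R^-1)).
- near=> n.
  have n0 : 0 < n%:R :> R by rewrite ltr0n; near: n; exists 1%N.
  rewrite mulr_ge0 ?normal_pdf_ge0//= normal_pdfE// /normal_fun subr0.
  set v := s ^+ 2 *+ 2.
  have v0 : 0 < v by rewrite pmulrn_lgt0// exprn_even_gt0.
  rewrite mulrCA -mulrA ler_pM2l ?normal_peak_gt0//.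
  have := expR_ge1Dx (n%:R ^+ 2 / v); set e := expR _ => he.
  have -> : expR (- n%:R ^+ 2 / v) = e^-1 by rewrite mulNr expRN.
  have e0 : 0 < e by exact: expR_gt0.
  rewrite ler_pdivrMr// mulrAC ler_pdivlMr// -expr2 mulrC -ler_pdivrMr//.
  by apply: le_trans he; rewrite lerDr.
- exact: cvg_cst.
- rewrite -[X in _ --> X](mulr0 (normal_peak s * (s ^+ 2 *+ 2))).
  apply: cvgM; first exact: cvg_cst.
  apply/gtr0_cvgV0; last exact: cvgr_idn.
  by near=> n; rewrite ltr0n; near: n; exists 1%N.
Unshelve. all: by end_near. Qed.

Lemma integral_sqr_normal_pdf :
  (\int[mu]_x (x ^+ 2 * pdf x)%:E = (s ^+ 2)%:E)%E.
Proof.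
have f0 x : 0 <= x ^+ 2 * pdf x by rewrite mulr_ge0 ?sqr_ge0 ?normal_pdf_ge0.
have cf := continuous_sqr_normal_pdf.
have half : (\int[mu]_(x in `[0%R, +oo[) (x ^+ 2 * pdf x)%:E =
    (s ^+ 2)%:E * \int[mu]_(x in `[0%R, +oo[) (pdf x)%:E)%E.
  have cl := @ge0_cvgn_integral R mu _ f0 (continuous_measurable_fun cf).
  have cr := @ge0_cvgn_integral R mu pdf (normal_pdf_ge0 0 s)
    (measurable_normal_pdf 0 s).
  apply: (cvg_unique _ cl) => //.
  (* The zero summand is inserted as the limit of the boundary term. *)
  have -> : ((s ^+ 2)%:E * \int[mu]_(x in `[0%R, +oo[) (pdf x)%:E)%E =
      ((- (s ^+ 2 * 0))%:E + (s ^+ 2)%:E * \int[mu]_(x in `[0%R, +oo[) (pdf x)%:E)%E.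
    by rewrite mulr0 oppr0 add0e.
  apply: (@cvg_trans _ ((fun n : nat => (- (s ^+ 2 * (n%:R * pdf n%:R)))%:E +
      (s ^+ 2)%:E * \int[mu]_(x in `[0%R, n%:R]) (pdf x)%:E)%E @ \oo)).
    apply: near_eq_cvg; near=> n; rewrite integral_itv_sqr_normal_pdf//.
    by rewrite ltr0n; near: n; exists 1%N.
  apply: cvgeD.
  - by rewrite fin_num_adde_defr.
  - apply: cvg_EFin; first by near=> n.
    by apply: cvgN; apply: cvgM; [exact: cvg_cst|exact: cvg_mul_normal_pdf].
  - by apply: cvgeZl.
(* Both integrands are even, so doubling the half-line identity reduces the claim to the total mass
   1 of [pdf]. *)
rewrite ge0_symfun_integralT//; last by move=> x /=; rewrite sqrrN normal_pdf_sym.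
rewrite -set_itvcy half muleCA -[RHS]mule1; congr (_ * _)%E.
rewrite -(integral_normal_pdf 0 s) ge0_symfun_integralT//.
- by rewrite set_itvcy.
- by move=> x; exact: normal_pdf_ge0.
- exact: continuous_normal_pdf.
- by move=> x /=; rewrite normal_pdf_sym.
Unshelve. all: by end_near. Qed.

End normal_moments.

(** * Integration against normal laws *)

Section normal_expectation.
Variables (R : realType) (m s : R).
Let mu := @lebesgue_measure R.
Local Open Scope ereal_scope.

(** The Radon-Nikodym derivative of the normal law agrees almost everywhere with [normal_pdf], since
    both have the same integral over every measurable set. *)
Lemma ge0_integral_normal_prob (f : R -> \bar R) :
  measurable_fun [set: R] f -> (forall x, 0 <= f x) ->
  \int[normal_prob m s]_x f x = \int[mu]_x (f x * (normal_pdf m s x)%:E).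
Proof.
move=> mf f0; have dom := normal_prob_dominates m s.
rewrite -(Radon_Nikodym_SigmaFinite.change_of_variables dom)//.
have ig := Radon_Nikodym_SigmaFinite.f_integrable dom.
have mpdf : measurable_fun [set: R] (fun x => (normal_pdf m s x)%:E).
  by apply/measurable_EFinP; exact: measurable_normal_pdf.
apply: ae_eq_integral => //.
- by apply: emeasurable_funM => //; exact: measurable_int ig.
- exact: emeasurable_funM.
- apply: ae_eqe_mul2l; apply: integral_ae_eq => // E _ mE.
  by rewrite -Radon_Nikodym_SigmaFinite.f_integral.
Qed.

Lemma ge0_integral_opp (f : R -> \bar R) :
  measurable_fun [set: R] f -> (forall x, 0 <= f x) ->
  \int[mu]_x f (- x)%R = \int[mu]_x f x.
Proof.
move=> mf f0.
transitivity (\int[pushforward mu (-%R : _ -> measurableTypeR R)]_x f x).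
  by rewrite ge0_integral_pushforward.
by apply: eq_measure_integral => A mA _; exact: lebesgue_measureN.
Qed.

End normal_expectation.

(** * Moments of Gaussian random variables *)

Section gaussian_random_variable.
Variables (d : measure_display) (T : measurableType d) (R : realType).
Variable P : probability T R.
Implicit Types X : {RV P >-> R}.
Local Open Scope ereal_scope.

Lemma ge0_integral_gaussian X (mu v : R) (f : R -> \bar R) :
  is_gaussian X mu v -> measurable_fun [set: R] f -> (forall x, 0 <= f x) ->
  \int[P]_t f (X t) =
  \int[lebesgue_measure]_x (f x * (gaussian_pdf mu v x)%:E).
Proof.
move=> gX mf f0; rewrite -ge0_integral_normal_prob//.
rewrite -[LHS](ge0_integral_distribution X mf f0).
(* The two sides use the measurable structures [R] and [measurableTypeR R],
   which have the same measurable sets but distinct displays. *)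
pose idR : measurableTypeR R -> R := id.
transitivity (\int[pushforward (normal_prob mu (Num.sqrt v)) idR]_x f x).
  apply: (@eq_measure_integral _ R R setT (pushforward (normal_prob mu (Num.sqrt v)) idR)).
    by move=> _ B mB; rewrite setTI.
  by move=> midR B mB _; exact: gX.
by rewrite ge0_integral_pushforward// => _ B mB; rewrite setTI.
Qed.

Lemma gaussian_second_moment X (v : R) : (0 < v)%R -> is_gaussian X 0 v ->
  \int[P]_t (X t ^+ 2)%:E = v%:E.
Proof.
move=> v0 gX.
rewrite (@ge0_integral_gaussian X 0 v (fun x => (x ^+ 2)%:E))//; last 2 first.
- by apply/measurable_EFinP; exact: measurable_funX.
- by move=> x; rewrite lee_fin sqr_ge0.
under eq_integral do rewrite -EFinM.
by rewrite integral_sqr_normal_pdf ?sqr_sqrtr ?ltW// gt_eqF// sqrtr_gt0.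
Qed.

Lemma gaussian_sqr_integrable X (v : R) : (0 < v)%R -> is_gaussian X 0 v ->
  P.-integrable [set: T] (fun t => (X t ^+ 2)%:E).
Proof.
move=> v0 gX; apply/integrableP; split.
  by apply/measurable_EFinP; exact: measurable_funX.
under eq_integral do rewrite gee0_abs ?lee_fin ?sqr_ge0//.
by rewrite (gaussian_second_moment v0 gX) ltry.
Qed.

(** On a probability space 1 + X^2 is an integrable bound for |X|, by (|X| - 1)^2 >= 0. *)
Lemma integrable_of_sqr (X : T -> R) : measurable_fun [set: T] X ->
  P.-integrable [set: T] (fun t => (X t ^+ 2)%:E) ->
  P.-integrable [set: T] (fun t => (X t)%:E).
Proof.
move=> mX iX.
have i1 : P.-integrable [set: T] (fun t => 1%:E + (X t ^+ 2)%:E).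
  by apply: integrableD => //; exact: finite_measure_integrable_cst.
apply: le_integrable i1 => //; first exact/measurable_EFinP.
move=> t _; rewrite -EFinD !abse_EFin lee_fin.
have := sqr_ge0 (X t); have := sqr_ge0 (`|X t| - 1)%R.
rewrite sqrrB expr1n -normrX => h1 h2.
rewrite [leRHS]ger0_norm ?addr_ge0//.
have := real_normK (num_real (X t)); have := normr_ge0 (X t).
by move: h1 h2; rewrite normrX; nra.
Qed.

(** As [ge0_integral_gaussian] treats nonnegative integrands, X is split into positive parts, X =
    p(X) - p(-X). Their integrals agree because the density is even, and they are finite, so the
    difference is 0. *)
Lemma gaussian_expectation0 X (v : R) : (0 < v)%R -> is_gaussian X 0 v ->
  \int[P]_t (X t)%:E = 0.
Proof.
move=> v0 gX.
pose p (x : R) := (Num.max x 0)%:E : \bar R.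
have mp : measurable_fun [set: R] p.
  by apply/measurable_EFinP; exact: measurable_maxr.
have p0 x : 0 <= p x by rewrite lee_fin le_max lexx orbT.
have mpN : measurable_fun [set: R] (fun x => p (- x)%R).
  by apply: measurableT_comp.
have iX : P.-integrable [set: T] (fun t => (X t)%:E).
  by apply: integrable_of_sqr => //; exact: gaussian_sqr_integrable gX.
have ipX : P.-integrable [set: T] (fun t => p (X t)).
  apply: le_integrable iX => //; first exact: measurableT_comp.
  move=> t _; rewrite !abse_EFin lee_fin.
  by rewrite [leLHS]ger0_norm ?le_max ?lexx ?orbT// ge_max ler_norm normr_ge0.
have eqN : \int[P]_t p (- X t)%R = \int[P]_t p (X t).
  rewrite (@ge0_integral_gaussian X 0 v (fun x => p (- x)%R))//.
  rewrite (@ge0_integral_gaussian X 0 v p)//.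
  rewrite -(@ge0_integral_opp _ (fun x => p x * (gaussian_pdf 0 v x)%:E)).
  - by apply: eq_integral => x _; rewrite /gaussian_pdf normal_pdf_sym// gt_eqF// sqrtr_gt0.
  - apply: emeasurable_funM => //; apply/measurable_EFinP.
    exact: measurable_normal_pdf.
  - by move=> x; rewrite mule_ge0// lee_fin normal_pdf_ge0.
have ipNX : P.-integrable [set: T] (fun t => p (- X t)%R).
  apply: le_integrable iX => //; first by apply: measurableT_comp => //; exact: measurableT_comp.
  move=> t _; rewrite !abse_EFin lee_fin.
  by rewrite [leLHS]ger0_norm ?le_max ?lexx ?orbT// ge_max -normrN ler_norm normr_ge0.
transitivity (\int[P]_t (p (X t) - p (- X t)%R)).
  apply: eq_integral => t _; rewrite -EFinB; congr EFin.
  by case: (lerP (X t) 0) => h; case: (lerP (- X t)%R 0) => h'; lra.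
by rewrite integralB// eqN subee// -eqN integrable_fin_num.
Qed.

End gaussian_random_variable.

(** * From independence to uncorrelatedness *)

Section independent_product.
Variables (d : measure_display) (T : measurableType d) (R : realType).
Variable P : probability T R.
Implicit Types X Y : {RV P >-> R}.
Local Open Scope ereal_scope.

Lemma mutually_independent_pair (I : eqType) (D : {pred I})
    (X : I -> {RV P >-> R}) i j (A B : set R) :
  mutually_independent D X -> i \in D -> j \in D -> i != j ->
  measurable A -> measurable B ->
  P (X i @^-1` A `&` X j @^-1` B) = P (X i @^-1` A) * P (X j @^-1` B).
Proof.
move=> indX iD jD ij mA mB.
have ijD : {subset [:: i; j] <= D}.
  by move=> k; rewrite !inE => /orP[|] /eqP->.
have := indX [:: i; j] _ ijD (fun k => if k == i then A else B).
rewrite /= inE ij => /(_ isT) H.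
have : forall k, measurable (if k == i then A else B) by move=> k; case: ifP.
move=> /H; rewrite !big_cons big_nil mule1 eqxx eq_sym (negbTE ij) => <-.
congr (P _); apply/seteqP; split=> t /=.
  move=> [XA XB] k /=; rewrite !inE => /orP[|] /eqP->; first by rewrite eqxx.
  by rewrite eq_sym (negbTE ij).
move=> h; split.
  by have := h i; rewrite /= !inE eqxx; exact.
by have := h j; rewrite /= !inE !eqxx orbT eq_sym (negbTE ij); exact.
Qed.

Lemma integrable_prod X Y :
  P.-integrable [set: T] (fun t => (X t ^+ 2)%:E) ->
  P.-integrable [set: T] (fun t => (Y t ^+ 2)%:E) ->
  P.-integrable [set: T] (fun t => (X t * Y t)%:E).
Proof.
move=> iX iY; have iXY := integrableD measurableT iX iY.
apply: le_integrable iXY => //.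
  by apply/measurable_EFinP; exact: measurable_funM.
move=> t _; rewrite -EFinD !abse_EFin lee_fin [leRHS]ger0_norm ?addr_ge0 ?sqr_ge0//.
rewrite ler_norml; apply/andP; split; nra.
Qed.

(** A measure on the plane is determined by its values on rectangles, so the joint law is the
    product law. In the iterated integral, the inner one over the law of Y is x E[Y] = 0. *)
Lemma independent_integral_prod X Y :
  (forall A B : set R, measurable A -> measurable B ->
    P (X @^-1` A `&` Y @^-1` B) = P (X @^-1` A) * P (Y @^-1` B)) ->
  P.-integrable [set: T] (fun t => (X t * Y t)%:E) ->
  P.-integrable [set: T] (fun t => (Y t)%:E) ->
  \int[P]_t (Y t)%:E = 0 ->
  \int[P]_t (X t * Y t)%:E = 0.
Proof.
move=> indep iXY iY EY0.
pose Z t := (X t, Y t).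
have mZ : measurable_fun [set: T] Z by exact: measurable_fun_pair.
pose f (u : R * R) := (u.1 * u.2)%:E : \bar R.
have mf : measurable_fun [set: R * R] f.
  apply/measurable_EFinP; apply: measurable_funM.
    exact: measurable_fst.
  exact: measurable_snd.
have joint (C : set (R * R)) : measurable C ->
    (distribution P X \x distribution P Y) C = pushforward P Z C.
  move=> mC.
  by apply: (@product_measure_unique _ _ _ _ _ (distribution P X) (distribution P Y)
    (pushforward P Z)).
have ifZ : (distribution P X \x distribution P Y).-integrable [set: R * R] f.
  have := integrable_pushforward mZ mf iXY measurableT.
  move=> /integrableP[_ h]; apply/integrableP; split=> //; apply: le_lt_trans h.
  rewrite (@eq_measure_integral _ _ _ _ (pushforward P Z))// => C mC _.
  exact: joint.
transitivity (\int[pushforward P Z]_u f u).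
  by rewrite integral_pushforward.
transitivity (\int[distribution P X \x distribution P Y]_u f u).
  by apply: eq_measure_integral => C mC _; exact/esym/joint.
rewrite -integral12_prod_meas1//.
rewrite /fubini_F; apply: integral0_eq => x _; rewrite /f/=.
under eq_integral do rewrite EFinM.
have iYd : (distribution P Y).-integrable [set: R] EFin.
  by apply: integrable_pushforward.
rewrite integralZl//.
have -> : \int[distribution P Y]_y y%:E = 0.
  by rewrite -EY0 -(@integral_distribution _ _ _ _ _ _ Y EFin).
by rewrite mule0.
Qed.

End independent_product.

(** * The score of Gaussian releases *)

Section gaussian_score.
Variables (R : realType) (m : nat).

Lemma ln_prod (I : Type) (r : seq I) (F : I -> R) : (forall i, 0 < F i) ->
  ln (\prod_(i <- r) F i) = \sum_(i <- r) ln (F i).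
Proof.
move=> F0; elim: r => [|i r IHr]; first by rewrite !big_nil ln1.
by rewrite !big_cons lnM ?IHr// posrE// prodr_gt0.
Qed.

Lemma ln_gaussian_pdf (mu v x : R) : 0 < v ->
  ln (gaussian_pdf mu v x) =
  ln (normal_peak (Num.sqrt v)) - (x - mu) ^+ 2 / (2 * v).
Proof.
move=> v0; have s0 : Num.sqrt v != 0 by rewrite gt_eqF// sqrtr_gt0.
rewrite /gaussian_pdf normal_pdfE// lnM ?posrE ?normal_peak_gt0 ?expR_gt0//.
by rewrite /normal_fun expRK sqr_sqrtr ?ltW// mulNr -mulr_natl.
Qed.

Lemma gaussian_pdf_gt0 (mu v x : R) : 0 < v -> 0 < gaussian_pdf mu v x.
Proof.
move=> v0; have s0 : Num.sqrt v != 0 by rewrite gt_eqF// sqrtr_gt0.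
by rewrite /gaussian_pdf normal_pdfE// mulr_gt0 ?normal_peak_gt0 ?expR_gt0.
Qed.

Lemma is_derive_ln_gaussian_pdf (f : 'cV[R]_m -> R) (z e : 'cV[R]_m) (v x : R) :
  0 < v -> differentiable f z ->
  is_derive z e (fun u => ln (gaussian_pdf (f u) v x))
    ((x - f z) / v * 'D_e f z).
Proof.
move=> v0 df.
rewrite (_ : (fun u => _) =
  fun u => ln (normal_peak (Num.sqrt v)) - (x - f u) ^+ 2 / (2 * v)); last first.
  by apply/funext => u; rewrite ln_gaussian_pdf.
have /derivableP H : derivable f z e by exact: diff_derivable.
apply: is_derive_eq.
rewrite !scaler0 /GRing.scale/=; field.
by rewrite gt_eqF.
Qed.

Lemma score_release_density (q : nat -> 'cV[R]_m -> R) (Delta kappa : nat -> R)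
    (L : nat) (z : 'cV[R]_m) (y : nat -> R) i :
  (forall l, (0 < l)%N -> differentiable (q l) z) ->
  (forall l, (0 < l)%N -> 0 < noise_variance Delta kappa L l) ->
  score (release_density q Delta kappa L) z y i 0 =
  \sum_(l < L) (y l.+1 - q l.+1 z) / noise_variance Delta kappa L l.+1 *
    partial (q l.+1) i z.
Proof.
move=> dq v0; rewrite /score /gradient mxE /partial /release_density.
(* The log density becomes a sum of functions, to be differentiated termwise; the ordinal [l] stands
   for release [l.+1]. *)
pose h (l : 'I_L) u :=
  ln (gaussian_pdf (q l.+1 u) (noise_variance Delta kappa L l.+1) (y l.+1)).
rewrite (_ : (fun v => _) = \sum_(l < L) h l); last first.
  apply/funext => u; rewrite fct_sumE big_add1 big_mkord ln_prod// => l.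
  exact/gaussian_pdf_gt0/v0.
have dh l : is_derive z (delta_mx i 0) (h l)
    ((y l.+1 - q l.+1 z) / noise_variance Delta kappa L l.+1 *
      'D_(delta_mx i 0) (q l.+1) z).
  by apply: is_derive_ln_gaussian_pdf; [exact: v0|exact: dq].
by rewrite (@derive_val _ _ _ _ _ _ _ (is_derive_sum dh)).
Qed.

End gaussian_score.

(** Orthogonality in L^2: only the diagonal of the double sum survives. *)
Lemma integral_mul_linear_comb (d : measure_display) (T : measurableType d)
    (R : realType) (P : probability T R) (n : nat) (X : 'I_n -> T -> R)
    (a b v : 'I_n -> R) :
  (forall l k, P.-integrable [set: T] (fun t => (X l t * X k t)%:E)) ->
  (forall l k, (\int[P]_t (X l t * X k t)%:E = (if l == k then v l else 0)%:E)%E) ->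
  (\int[P]_t ((\sum_(l < n) a l * X l t) * (\sum_(k < n) b k * X k t))%:E =
   (\sum_(l < n) a l * b l * v l)%:E)%E.
Proof.
move=> iX EX.
have E t : ((\sum_(l < n) a l * X l t) * (\sum_(k < n) b k * X k t))%:E =
    (\sum_(l < n) \sum_(k < n) (a l * b k)%:E * (X l t * X k t)%:E)%E.
  rewrite mulr_suml -sumEFin; apply: eq_bigr => l _.
  rewrite mulr_sumr -sumEFin; apply: eq_bigr => k _.
  by rewrite -EFinM mulrACA.
under eq_integral do rewrite E.
have iaX l k : P.-integrable [set: T]
    (fun t => (a l * b k)%:E * (X l t * X k t)%:E)%E by exact: integrableZl.
rewrite integral_sum//; last by move=> l; apply: integrable_sum.
rewrite -sumEFin; apply: eq_bigr => l _.
rewrite integral_sum// (bigD1 l)//= big1 => [|k kl]; last first.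
  by rewrite integralZl// EX eq_sym (negbTE kl) mule0.
by rewrite integralZl// EX eqxx adde0.
Qed.

(** * Fisher information of the first L releases *)

Section gaussian_fisher_information.
Variables (R : realType) (m : nat) (z : 'cV[R]_m) (q : nat -> 'cV[R]_m -> R).
Variables (Delta kappa : nat -> R) (L : nat).
Variables (d : measure_display) (T : measurableType d) (P : probability T R).
Variable w : nat -> {RV P >-> R}.
Hypothesis q_diff : forall l, (0 < l)%N -> differentiable (q l) z.
Hypothesis Delta_gt0 : forall l, (0 < l)%N -> 0 < Delta l.
Hypothesis kappa_gt0 : 0 < kappa L.
Hypothesis w_indep : mutually_independent [pred l : nat | (0 < l <= L)%N] w.
Hypothesis w_gauss : forall l, (0 < l <= L)%N ->
  is_gaussian (w l) 0 (noise_variance Delta kappa L l).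

Lemma noise_variance_gt0 l : (0 < l)%N -> 0 < noise_variance Delta kappa L l.
Proof. by move=> l0; rewrite mulr_gt0// exprn_gt0// Delta_gt0. Qed.

Lemma release_informationE :
  release_information q Delta kappa w L z = (kappa L)^-1 *: Amx q Delta L z.
Proof.
have lL (l : 'I_L) : (0 < l.+1 <= L)%N by rewrite ltn0Sn ltn_ord.
have v0 (l : 'I_L) := noise_variance_gt0 (ltn0Sn l).
have iw2 (l : 'I_L) := gaussian_sqr_integrable (v0 l) (w_gauss (lL l)).
apply/matrixP => i j; rewrite [LHS]mxE mxE unlock.
(* At the observed release, y - q(z) is the noise itself, so the score is linear in the noises with
   coefficients [c]. Each diagonal term then has one inverse variance left, which splits into
   1/kappa_L and the whitening factor. *)
pose c (i : 'I_m) (l : 'I_L) :=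
  (noise_variance Delta kappa L l.+1)^-1 * partial (q l.+1) i z.
have sE t i0 : score (release_density q Delta kappa L) z (release q w z t) i0 0 =
    \sum_(l < L) c i0 l * w l.+1 t.
  rewrite score_release_density//; last exact: noise_variance_gt0.
  by apply: eq_bigr => l _; rewrite /release addrAC subrr add0r /c; ring.
under eq_integral do rewrite !sE.
rewrite (@integral_mul_linear_comb _ _ _ _ _ (fun l t => w l.+1 t) (c i) (c j)
  (fun l => noise_variance Delta kappa L l.+1)); last 2 first.
- by move=> l k; exact: integrable_prod.
- move=> l k; case: eqVneq => [<-|lk].
    exact: (gaussian_second_moment (v0 l) (w_gauss (lL l))).
  apply: independent_integral_prod.
  + move=> A B mA mB; apply: (mutually_independent_pair w_indep) => //.
      by rewrite inE; exact: lL.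
    by rewrite inE; exact: lL.
  + exact: integrable_prod.
  + exact: integrable_of_sqr.
  + exact: (gaussian_expectation0 (v0 k) (w_gauss (lL k))).
rewrite /= /Amx summxE big_add1 big_mkord mulr_sumr; apply: eq_bigr => l _.
rewrite mxE big_ord1 !mxE /c /noise_variance; field.
by rewrite !gt_eqF ?Delta_gt0.
Qed.

End gaussian_fisher_information.

Lemma Amx_psd (R : realType) (m : nat) (q : nat -> 'cV[R]_m -> R)
    (Delta : nat -> R) (L : nat) (z : 'cV[R]_m) : psdmx (Amx q Delta L z).
Proof.
split.
  by rewrite /Amx linear_sum/=; apply: eq_bigr => l _; rewrite trmx_mul trmxK.
move=> v; rewrite bform_sum; apply: sumr_ge0 => l _.
set g := whitened_gradient _ _ _ _.
rewrite /bform mulmxA -mulmxA mxE big_ord1.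
have -> : v^T *m g = (g^T *m v)^T by rewrite trmx_mul trmxK.
by rewrite mxE -expr2 sqr_ge0.
Qed.

(** * Asymptotics and minimizers of the benchmark *)

Section crb_asymptotics.
Variables (R : realType) (m : nat) (m_gt0 : (0 < m)%N).
Variables (A : nat -> 'M[R]_m) (kappa : nat -> R) (C : nat -> \bar R).
Hypothesis A_psd : forall L, psdmx (A L).
Hypothesis kappa_gt0 : forall L, (0 < L)%N -> 0 < kappa L.
Hypothesis CE : forall L, (0 < L)%N -> C L = cramer_rao ((kappa L)^-1 *: A L).

Let lam L := lambda_min (A L).

Lemma crb_singular L : (0 < L)%N -> ~~ (0 < lam L) -> C L = +oo%E.
Proof.
by move=> L0 lL; rewrite CE//; apply: cramer_rao_singular => //; exact: kappa_gt0.
Qed.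

Lemma crb_lower_bound L : (0 < L)%N -> 0 < lam L -> ((kappa L / lam L)%:E <= C L)%E.
Proof.
move=> L0 lL; rewrite CE//.
by have /andP[] := cramer_rao_bounds m_gt0 (kappa_gt0 L0) (A_psd L) lL.
Qed.

Lemma crb_upper_bound L : (0 < L)%N -> 0 < lam L ->
  (C L <= (m%:R * (kappa L / lam L))%:E)%E.
Proof.
move=> L0 lL; rewrite CE//.
by have /andP[] := cramer_rao_bounds m_gt0 (kappa_gt0 L0) (A_psd L) lL.
Qed.

Lemma crb_cvgy : (forall e, 0 < e -> \forall L \near \oo, `|lam L| <= e * `|kappa L|) ->
  C L @[L --> \oo] --> +oo%E.
Proof.
move=> lo; apply/cvgeyPge => M.
(* [M] may have any sign; this majorant is positive, so its inverse can serve as the epsilon of the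
   little-o. *)
have M0 : 0 < `|M| + 1 by rewrite ltr_wpDl.
have Mi : 0 < (`|M| + 1)^-1 by rewrite invr_gt0.
near=> L.
have L0 : (0 < L)%N by near: L; exists 1%N.
have := kappa_gt0 L0; have : `|lam L| <= (`|M| + 1)^-1 * `|kappa L|.
  by near: L; exact: lo.
have [lL|/(crb_singular L0)->] := boolP (0 < lam L); last by rewrite leey.
move=> + k0; rewrite (gtr0_norm lL) (gtr0_norm k0) ler_pdivlMl// => h.
apply: le_trans (crb_lower_bound L0 lL); rewrite lee_fin ler_pdivlMr//.
apply: le_trans h; rewrite ler_pM2r//.
by rewrite (le_trans (ler_norm M))// lerDl.
Unshelve. all: by end_near. Qed.

Lemma exists_min_window (f : nat -> \bar R) a K :
  exists2 L, (a <= L)%N & forall L', (a <= L' <= a + K)%N -> (f L <= f L')%E.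
Proof.
elim: K => [|K [L aL fL]].
  by exists a => // L'; rewrite addn0 -eqn_leq => /eqP->.
have [h|h] := leP (f L) (f (a + K.+1)%N).
  exists L => // L' /andP[aL']; rewrite leq_eqVlt => /predU1P[->//|].
  by rewrite addnS ltnS => L'K; apply: fL; rewrite aL'.
exists (a + K.+1)%N; first exact: leq_addr.
move=> L' /andP[aL']; rewrite leq_eqVlt => /predU1P[->//|].
rewrite addnS ltnS => L'K; rewrite -addnS; apply: le_trans (ltW h) _.
by apply: fL; rewrite aL'.
Qed.

Lemma crb_minimizer Lid : (0 < Lid)%N -> 0 < lam Lid ->
  (forall L, (0 < L < Lid)%N -> ~~ (0 < lam L)) ->
  C L @[L --> \oo] --> +oo%E ->
  exists Lstar, (Lid <= Lstar)%N /\ forall L, (0 < L)%N -> (C Lstar <= C L)%E.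
Proof.
(* The threshold is the finite upper bound on [C Lid]: no stage beyond [K] can beat [Lid]. Stages
   before [Lid] have value [+oo], so the window from [Lid] to [Lid + K] decides. *)
move=> Lid0 lLid sing /cvgeyPge /(_ (m%:R * (kappa Lid / lam Lid)))[K _ hK].
have [L aL fL] := exists_min_window C Lid K.
exists L; split=> // L' L'0.
have [L'Lid|LidL'] := ltnP L' Lid.
  by rewrite (crb_singular L'0) ?leey// sing// L'0.
have [L'K|KL'] := leqP L' (Lid + K); first by rewrite fL// LidL'.
apply: (@le_trans _ _ (C Lid)); first by rewrite fL// leqnn leq_addr.
apply: le_trans (crb_upper_bound Lid0 lLid) _; apply: hK => /=.
by rewrite (leq_trans _ (ltnW KL'))// leq_addl.
Qed.

(** The forward direction uses the lower bound on [C], the converse the upper bound; each must first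
    secure [0 < lam L] eventually. *)
Lemma crb_cvg0 : C L @[L --> \oo] --> 0%E <-> lam L / kappa L @[L --> \oo] --> +oo.
Proof.
split=> [/fine_cvgP[Cfin /cvgrPdist_lt C0]|/cvgryPge ly].
  apply/cvgryPge => M.
  have M0 : 0 < `|M| + 1 by rewrite ltr_wpDl.
  have Mi : 0 < (`|M| + 1)^-1 by rewrite invr_gt0.
  near=> L.
  have L0 : (0 < L)%N by near: L; exists 1%N.
  have CL : C L \is a fin_num by near: L.
  have : `|0 - fine (C L)| < (`|M| + 1)^-1 by near: L; exact: C0.
  rewrite sub0r normrN => /(le_lt_trans (ler_norm _)) h.
  (* Convergence to a finite limit makes [C L] eventually finite, which excludes singular stages. *)
  have lL : 0 < lam L.
    by apply: contraT => /(crb_singular L0) Ly; move: CL; rewrite Ly.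
  have k0 := kappa_gt0 L0.
  have : (kappa L / lam L) < (`|M| + 1)^-1.
    apply: le_lt_trans h; rewrite -lee_fin fineK//; exact: crb_lower_bound.
  rewrite ltr_pdivrMr// mulrC -ltr_pdivrMr// invrK => h'.
  rewrite ler_pdivlMr//; apply: le_trans (_ : (`|M| + 1) * kappa L <= _); last first.
    by rewrite mulrC ltW.
  by rewrite ler_pM2r// (le_trans (ler_norm M))// lerDl.
have lpos : \forall L \near \oo, (0 < L)%N /\ 0 < lam L.
  near=> L.
  have L0 : (0 < L)%N by near: L; exists 1%N.
  split=> //; have : 1 <= lam L / kappa L by near: L; exact: ly.
  by rewrite ler_pdivlMr ?kappa_gt0// mul1r; apply: lt_le_trans; exact: kappa_gt0.
have Cb L : (0 < L)%N -> 0 < lam L ->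
    (0%E <= C L)%E /\ (C L <= (m%:R * (kappa L / lam L))%:E)%E.
  move=> L0 lL; split; last exact: crb_upper_bound.
  apply: le_trans (crb_lower_bound L0 lL).
  by rewrite lee_fin divr_ge0// ltW// kappa_gt0.
have Cfin L : (0 < L)%N -> 0 < lam L -> C L \is a fin_num.
  move=> L0 lL; have [C0 Cu] := Cb L L0 lL.
  by rewrite ge0_fin_numE// (le_lt_trans Cu)// ltry.
apply/fine_cvgP; split.
  by apply: filterS lpos => L [L0 lL]; exact: Cfin.
apply/cvgrPdist_le => e e0; near=> L.
have [L0 lL] : (0 < L)%N /\ 0 < lam L by near: L.
have [C0 Cu] := Cb L L0 lL.
rewrite sub0r normrN ger0_norm ?fine_ge0//.
rewrite -lee_fin fineK ?Cfin//; apply: le_trans Cu _; rewrite lee_fin.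
have k0 := kappa_gt0 L0.
(* This threshold makes the upper bound m kappa_L / lambda_L at most [e]. *)
have : m%:R / e <= lam L / kappa L by near: L; exact: ly.
rewrite ler_pdivrMr// mulrAC ler_pdivlMr// => h.
by rewrite mulrA ler_pdivrMr// [leRHS]mulrC.
Unshelve. all: by end_near. Qed.

End crb_asymptotics.

Theorem corollary1 (R : realType) (m : nat) (m_gt0 : (0 < m)%N)
    (z : 'cV[R]_m) (z_sorted : in_sorted_chamber z)
    (q : nat -> 'cV[R]_m -> R)
    (q_diff : forall l, (0 < l)%N -> differentiable (q l) z)
    (Delta : nat -> R) (Delta_gt0 : forall l, (0 < l)%N -> 0 < Delta l)
    (kappa : nat -> R) (kappa_gt0 : forall L, (0 < L)%N -> 0 < kappa L)
    (d : nat -> measure_display) (T : forall L, measurableType (d L))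
    (P : forall L, probability (T L) R)
    (w : forall L, nat -> {RV (P L) >-> R})
    (w_indep : forall L, (0 < L)%N ->
       mutually_independent [pred l : nat | (0 < l <= L)%N] (w L))
    (w_gauss : forall L l, (0 < L)%N -> (0 < l <= L)%N ->
       is_gaussian (w L l) 0 (noise_variance Delta kappa L l)) :
  let A (L : nat) : 'M[R]_m := Amx q Delta L z in
  let CRB_unlab (L : nat) : \bar R :=
    cramer_rao (release_information q Delta kappa (w L) L z) in
  (forall Lid : nat,
     [/\ (0 < Lid)%N, posdefmx (A Lid) &
         forall L, (0 < L < Lid)%N -> ~ posdefmx (A L)] ->
     (fun L => lambda_min (A L)) =o_\oo kappa ->
     [/\ CRB_unlab L @[L --> \oo] --> +oo%E,
         forall L, (0 < L < Lid)%N -> (\rank (A L) < m)%N &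
         exists Lstar : nat, (Lid <= Lstar)%N /\
           forall L, (0 < L)%N -> (CRB_unlab Lstar <= CRB_unlab L)%E]) /\
  (CRB_unlab L @[L --> \oo] --> 0%E <->
   lambda_min (A L) / kappa L @[L --> \oo] --> +oo).
Proof.
move=> A CRB_unlab.
have Apsd L : psdmx (A L) by exact: Amx_psd.
(* The noises and their probability spaces disappear here; all that follows is about deterministic
   sequences. *)
have CE L : (0 < L)%N -> CRB_unlab L = cramer_rao ((kappa L)^-1 *: A L).
  move=> L0; rewrite /CRB_unlab (@release_informationE _ _ _ _ _ _ _ _ _ _ (w L))//.
  - exact: kappa_gt0.
  - exact: w_indep.
  - by move=> l; exact: w_gauss.
split=> [Lid [Lid0 Apd Anpd] /eqoP lo|]; last exact: crb_cvg0.
have sing L : (0 < L < Lid)%N -> A L \notin unitmx.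
  by move=> LLid; apply/negP => /(psd_unitmx_posdef (Apsd L)); exact: Anpd.
have Cy : CRB_unlab L @[L --> \oo] --> +oo%E by exact: (crb_cvgy m_gt0 Apsd _ CE).
split=> // [L LLid|].
  by rewrite ltn_neqAle rank_leq_row andbT; have := sing L LLid; rewrite -row_free_unit.
apply: (crb_minimizer m_gt0 Apsd _ CE) => // [|L LLid].
  by rewrite (lambda_min_gt0 m_gt0 (Apsd _)) posdef_unitmx.
by rewrite (lambda_min_gt0 m_gt0 (Apsd _)) sing.
Qed.
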